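(* Let $n\ge1$ and $m\ge 2n-2$ be integers, and consider the table with $m$ rows and $n$ columns. Then (i) $\sum_{i=0}^{n-1}\mathcal{D}(i,1)\mathcal{D}(n-i,1)=3^{n-1}$; (ii) $\sum_{i=1}^{n-1}\mathcal{D}(i,1)\mathcal{D}(n-i,1)=\sum_{i=0}^{n-2}3^{n-i-2}\mathcal{M}_i$; (iii) $\mathcal{I}_m(n)=(3m-2n+2)3^{n-2}+2\sum_{k=0}^{n-3}(n-k-2)3^{n-k-3}\mathcal{M}_k$.
   Context: $\mathcal{I}_m(n)$ is the number of sequences $(r_1,\dots,r_n)$ with $r_i\in\{1,\dots,m\}$, $|r_{i+1}-r_i|\le1$ (lattice paths with steps $(1,0),(1,1),(1,-1)$ from the first to the last column of the $m$-row, $n$-column table, staying inside). For $s\ge1$, $\mathcal{D}(s,t)$ is the number of sequences $(r_1,\dots,r_s)$ with values in $\{1,\dots,m\}$, $|r_{i+1}-r_i|\le1$ and $r_s=t$ (paths from any cell of the first column to the cell in column $s$, row $t$); by convention $\mathcal{D}(0,1)=1$. $\mathcal{M}_k$ is the $k$-th Motzkin number (lattice paths from $(0,0)$ to $(k,0)$ with steps $(1,1),(1,-1),(1,0)$ never going below the $x$-axis; $\mathcal{M}_0=1$). Empty sums are $0$. *)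

(* Defs.v *)
From mathcomp Require Import all_boot all_order all_algebra.

Set Implicit Arguments.
Unset Strict Implicit.
Unset Printing Implicit Defensive.

Import Order.TTheory GRing.Theory Num.Theory.
Import IntDist.

(* 'I_m is numbered from 0; [rows] translates to the row numbers 1, ..., m. *)
Definition rows (m : nat) (r : seq 'I_m) : seq nat :=
  [seq (nat_of_ord i).+1 | i <- r].

Definition adjacent_rows (a b : nat) : bool := (`|b - a| <= 1)%N.

Definition table_paths (m s : nat) : {set s.-tuple 'I_m} :=
  [set r : s.-tuple 'I_m | sorted adjacent_rows (rows r)].

Definition I_num (m n : nat) : nat := #|table_paths m n|.

(* D(0,1) = 1 is a convention; D(0,t) is meaningless for t <> 1 and is set
   to 0 here.  For s >= 1 the default value 0 of [last] is never used. *)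
Definition D_num (m s t : nat) : nat :=
  if s == 0 then (t == 1 : nat)
  else #|[set r : s.-tuple 'I_m in table_paths m s | last 0 (rows r) == t]|.

(* The elements 0, 1, 2 of 'I_3 encode the steps (1,-1), (1,0), (1,1). *)
Definition step_height (x : 'I_3) : int := (x%:Z - 1)%R.

Definition height (p : seq 'I_3) : int := (\sum_(x <- p) step_height x)%R.

Definition motzkin_paths (k : nat) : {set k.-tuple 'I_3} :=
  [set p : k.-tuple 'I_3 | [forall j : 'I_k.+1, (0 <= height (take j p))%R]
           && (height p == 0%R)].

Definition motzkin (k : nat) : nat := #|motzkin_paths k|.

(* Main.v *)
(** Write [P k] for the number of nonnegative walks of length [k] from height 0
    and [M k] for those that also end at 0.  Extending a walk by one step gives
    [P (k + 1) + M k = 3 P k], and cutting it at its last visit to 0 gives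
    [P k = M k + \sum_(a < k) M a * P (k - 1 - a)].  Both identities extend to
    an arbitrary starting height, where they follow by linearity from the
    one-step recurrence; together they yield
    [P k + \sum_(i < k) P i * P (k - 1 - i) = 3 ^ k].  The table is so high
    that a path ending in row 1 cannot cross the top row, so [D(k + 1, 1) = P k].
    Finally, extending a path in the table loses one step at the bottom row
    and one at the top row, so [I(k + 1) + 2 D(k, 1) = 3 I(k)]. *)
Require Import Defs.
From mathcomp Require Import all_boot all_order all_algebra.
From mathcomp Require Import zify lra.

(** * Walks on the half-line and on a segment *)

Definition half_step (u : nat -> nat) (t : nat) : nat :=
  u t + (0 < t) * u t.-1 + u t.+1.

Definition seg_step (m : nat) (u : nat -> nat) (t : nat) : nat :=
  u t + (0 < t) * u t.-1 + (t.+1 < m) * u t.+1.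

(** Each iteration prepends a step: [t] is the height where the walk starts, and the initial
    function prescribes where it may end. *)
Definition half_walks (k : nat) : nat -> nat := iter k half_step (fun=> 1).

Definition half_walks0 (k : nat) : nat -> nat :=
  iter k half_step (fun t => t == 0).

Definition seg_walks (m k : nat) : nat -> nat := iter k (seg_step m) (fun=> 1).

Arguments half_walks : simpl never.
Arguments half_walks0 : simpl never.
Arguments seg_walks : simpl never.

Lemma half_walksS k t :
  half_walks k.+1 t
  = half_walks k t + (0 < t) * half_walks k t.-1 + half_walks k t.+1.
Proof. by []. Qed.

Lemma half_walks0S k t :
  half_walks0 k.+1 t
  = half_walks0 k t + (0 < t) * half_walks0 k t.-1 + half_walks0 k t.+1.
Proof. by []. Qed.

Lemma seg_walksS m k t :
  seg_walks m k.+1 t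
  = seg_walks m k t + (0 < t) * seg_walks m k t.-1
    + (t.+1 < m) * seg_walks m k t.+1.
Proof. by []. Qed.

Lemma half_walks_extend k t :
  half_walks k.+1 t + half_walks0 k t = 3 * half_walks k t.
Proof.
elim: k t => [|k IHk] t; first by case: t.
rewrite half_walksS half_walks0S [in RHS]half_walksS.
have := IHk t; have := IHk t.+1; have := IHk t.-1.
by case: t => [|t] /=; lia.
Qed.

(** Walks avoiding 0 are walks from [t.-1] raised by one. The others are cut at their last visit to
    0, at time [a]; if [a < k], the next step goes up and the remaining [k - a.+1] steps form a
    raised walk from 0. *)
Lemma half_walks_last_visit k t :
  half_walks k t = (0 < t) * half_walks k t.-1 + half_walks0 k t
    + \sum_(0 <= a < k) half_walks0 a t * half_walks (k - a.+1) 0.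
Proof.
elim: k t => [|k IHk] t; first by rewrite big_geq //; case: t.
rewrite big_nat_recl // subn1 /=.
have -> : \sum_(0 <= a < k) half_walks0 a.+1 t * half_walks (k.+1 - a.+2) 0
  = \sum_(0 <= a < k) half_walks0 a t * half_walks (k - a.+1) 0
    + (0 < t) * \sum_(0 <= a < k) half_walks0 a t.-1 * half_walks (k - a.+1) 0
    + \sum_(0 <= a < k) half_walks0 a t.+1 * half_walks (k - a.+1) 0.
  rewrite big_distrr -!big_split; apply: eq_bigr => a _ /=.
  by rewrite half_walks0S subSS !mulnDl mulnA.
have -> : half_walks0 0 t = (t == 0) by [].
rewrite (half_walksS k t) half_walks0S half_walksS.
have := IHk t; have := IHk t.+1; have := IHk t.-1.
by case: t => [|t] /=; lia.
Qed.

Lemma half_walks_convolution k :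
  half_walks k 0
    + \sum_(0 <= i < k) half_walks i 0 * half_walks (k - i.+1) 0 = 3 ^ k.
Proof.
elim: k => [|k IHk]; first by rewrite big_geq.
rewrite big_nat_recl // subn1 /= expnS -IHk.
(* By the last-visit identity at height 0, the second sum is [half_walks k 0 - half_walks0 k 0]. *)
have E : \sum_(0 <= i < k) half_walks i.+1 0 * half_walks (k.+1 - i.+2) 0
    + \sum_(0 <= i < k) half_walks0 i 0 * half_walks (k - i.+1) 0
    = 3 * \sum_(0 <= i < k) half_walks i 0 * half_walks (k - i.+1) 0.
  rewrite big_distrr -big_split; apply: eq_bigr => i _ /=.
  by rewrite subSS -mulnDl half_walks_extend mulnA.
have := half_walks_last_visit k 0; have := half_walks_extend k 0.
have -> : half_walks 0 0 = 1 by [].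
by move: E; lia.
Qed.

(** Among all [3 ^ k] unrestricted walks, those that become negative first do so right after a
    Motzkin path of some length [i]; the [k - i.+1] later steps are free. *)
Lemma half_walks_first_exit k :
  half_walks k 0 + \sum_(0 <= i < k) 3 ^ (k - i.+1) * half_walks0 i 0 = 3 ^ k.
Proof.
elim: k => [|k IHk]; first by rewrite big_geq.
rewrite big_nat_recr //= subnn expnS -IHk.
have -> : \sum_(0 <= i < k) 3 ^ (k.+1 - i.+1) * half_walks0 i 0
    = 3 * \sum_(0 <= i < k) 3 ^ (k - i.+1) * half_walks0 i 0.
  rewrite big_distrr; apply: eq_big_nat => i /andP[_ ltik] /=.
  by rewrite mulnA -expnS subSS subnSK.
by have := half_walks_extend k 0; lia.
Qed.

Lemma seg_walks_half m k t : t + k < m -> seg_walks m k t = half_walks k t.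
Proof.
elim: k t => [//|k IHk] t ltm; rewrite seg_walksS half_walksS.
by rewrite (IHk t) ?(IHk t.-1) ?(IHk t.+1); lia.
Qed.

(** Turning the table upside down exchanges the upper and lower neighbours. *)
Lemma seg_walks_sym m k t :
  t < m -> seg_walks m k (m - t.+1) = seg_walks m k t.
Proof.
elim: k t => [//|k IHk] t ltm; rewrite !seg_walksS (IHk t) // -!addnA.
congr (_ + _); rewrite addnC; congr (_ + _).
  case: t ltm => [|t] ltm; first by rewrite (_ : (_ < m) = false) //; lia.
  have -> : (m - t.+2).+1 = m - t.+1 by lia.
  by rewrite IHk /=; lia.
case: (ltnP t.+1 m) => ltm1; last by rewrite (_ : (0 < _) = false) //; lia.
have -> : (m - t.+1).-1 = m - t.+2 by lia.
by rewrite IHk //; lia.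
Qed.

(** * Counting tuples *)

Lemma card_set_sum (T : finType) (P : pred T) :
  #|[set x | P x]| = \sum_(x : T) P x.
Proof.
rewrite cardsE -sum1_card big_mkcond; apply: eq_bigr => x _.
by rewrite unfold_in; case: (P x).
Qed.

Lemma big_tuple_cons (T : finType) (s : nat) (F : seq T -> nat) :
  \sum_(r : s.+1.-tuple T) F r = \sum_x \sum_(r : s.-tuple T) F (x :: r).
Proof.
rewrite pair_big /=.
rewrite (reindex (fun p : T * s.-tuple T => cons_tuple p.1 p.2)) //.
exists (fun r => (thead r, behead_tuple r)) => [[x r] _|r _] /=.
  by congr (_, _); apply: val_inj.
by rewrite [r in RHS]tuple_eta; apply: val_inj.
Qed.

Lemma big_tuple0 (T : finType) (F : seq T -> nat) :
  \sum_(r : 0.-tuple T) F r = F [::].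
Proof.
rewrite (eq_bigr (fun=> F [::])) => [|r _]; last by rewrite tuple0.
by rewrite sum_nat_const card_tuple expn0 mul1n.
Qed.

Lemma sum_ord_delta m j (F : nat -> nat) :
  \sum_(x < m) (x == j :> nat) * F x = (j < m) * F j.
Proof.
case: ltnP => [ltjm|lemj]; last first.
  rewrite big1 // => x _.
  by have -> : (x == j :> nat) = false by have := ltn_ord x; lia.
rewrite (bigD1 (Ordinal ltjm)) //= eqxx big1 ?addn0 // => x.
by rewrite -val_eqE /= => /negbTE ->.
Qed.

Lemma adjacent_rowsE a b :
  adjacent_rows a b = (b == a) + (0 < a) * (b == a.-1) + (b == a.+1) :> nat.
Proof. by rewrite /adjacent_rows; lia. Qed.

Lemma adjacent_rows_sym : symmetric adjacent_rows.
Proof. by move=> a b; rewrite /adjacent_rows; lia. Qed.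

Lemma adjacent_rowsSS a b : adjacent_rows a.+1 b.+1 = adjacent_rows a b.
Proof. by rewrite /adjacent_rows; lia. Qed.

(** Identifies [seg_step] with the adjacency matrix of the rows, whose symmetry [I_numS]
    exploits. *)
Lemma sum_adjacent m t (F : nat -> nat) :
  t < m -> \sum_(x < m) adjacent_rows t x * F x = seg_step m F t.
Proof.
move=> ltm; rewrite /seg_step.
under eq_bigr => x _ do rewrite adjacent_rowsE !mulnDl -mulnA.
rewrite !big_split -big_distrr /= !sum_ord_delta ltm mul1n.
by rewrite (_ : t.-1 < m) ?mul1n //; lia.
Qed.

(** * Paths in the table *)

Lemma sum_path_rows m s (i : 'I_m) :
  \sum_(r : s.-tuple 'I_m) path adjacent_rows i.+1 (rows r) = seg_walks m s i.
Proof.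
elim: s i => [|s IHs] i.
  by rewrite (big_tuple0 _ (fun r => path adjacent_rows i.+1 (rows r))).
rewrite (big_tuple_cons _ _ (fun r => path adjacent_rows i.+1 (rows r))).
rewrite -[RHS]/(seg_step m (seg_walks m s) i) -sum_adjacent //; apply: eq_bigr => x _.
rewrite -IHs big_distrr; apply: eq_bigr => r _ /=.
by rewrite adjacent_rowsSS mulnb.
Qed.

Lemma I_numE m s : I_num m s.+1 = \sum_(i < m) seg_walks m s i.
Proof.
rewrite /I_num card_set_sum.
rewrite (big_tuple_cons _ _ (fun r => sorted adjacent_rows (rows r))).
by apply: eq_bigr => i _; rewrite -sum_path_rows.
Qed.

(* Reversing a path exchanges its first and its last cell. *)
Lemma D_numE m s (i : 'I_m) : D_num m s.+1 i.+1 = seg_walks m s i.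
Proof.
have revK : involutive (fun r : s.+1.-tuple 'I_m => rev_tuple r).
  by move=> r; apply: val_inj; rewrite /= revK.
rewrite /D_num /= card_set_sum (reindex_inj (inv_inj revK)).
pose F (r : seq 'I_m) :=
  (sorted adjacent_rows (rows r) && (head 0 (rows r) == i.+1)) : nat.
transitivity (\sum_(r : s.+1.-tuple 'I_m) F r).
  apply: eq_bigr => r _; rewrite inE /F /rows /= map_rev rev_sorted.
  rewrite (@eq_sorted _ _ adjacent_rows) => [|a b]; last exact: adjacent_rows_sym.
  by case: (tupleP r) => x t; rewrite /= rev_cons last_rcons.
rewrite big_tuple_cons (bigD1 i) //= addnC big1 => [|x neq_xi]; last first.
  by rewrite big1 // => r _; rewrite /F /= eqSS val_eqE (negbTE neq_xi) andbF.
by rewrite -sum_path_rows; apply: eq_bigr => r _; rewrite /F /= eqxx andbT.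
Qed.

Lemma D_num1 m s : s < m -> D_num m s.+1 1 = half_walks s 0.
Proof.
move=> ltsm; have m_gt0 : 0 < m by lia.
by rewrite (D_numE m s (Ordinal m_gt0)) seg_walks_half.
Qed.

Lemma I_numS m s :
  s < m -> I_num m s.+2 + 2 * half_walks s 0 = 3 * I_num m s.+1.
Proof.
move=> ltsm; rewrite !I_numE.
(* Each end of the table costs one neighbour; for [m = 1] both losses fall on the same row. *)
have E i : (i < m)%N ->
    seg_step m (fun=> 1) i + ((i == 0) + (i == m.-1)) = 3.
  by rewrite /seg_step; lia.
(* The symmetric adjacency matrix is moved from [seg_walks m s] to the constant function 1. *)
have -> : \sum_(i < m) seg_walks m s.+1 i
    = \sum_(x < m) seg_step m (fun=> 1) x * seg_walks m s x.
  rewrite (eq_bigr _ (fun i _ => esym (sum_adjacent _ _ _ (ltn_ord i)))).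
  rewrite exchange_big; apply: eq_bigr => x _ /=.
  rewrite -sum_adjacent // big_distrl; apply: eq_bigr => i _ /=.
  by rewrite muln1 adjacent_rows_sym.
have -> : 2 * half_walks s 0
    = \sum_(x < m) ((x == 0 :> nat) + (x == m.-1 :> nat)) * seg_walks m s x.
  under eq_bigr => x _ do rewrite mulnDl.
  rewrite big_split /= !sum_ord_delta -(seg_walks_half m) //.
  have m_gt0 : 0 < m by lia.
  have := seg_walks_sym m s 0 m_gt0; rewrite subn1 => ->.
  by rewrite ltn_predL m_gt0; lia.
rewrite -big_split big_distrr; apply: eq_bigr => x _ /=.
by rewrite -mulnDl E.
Qed.

(** * Motzkin paths *)

(** Reads the path step by step from height [t], so that counting follows the recurrence of
    [half_walks0]. *)
Fixpoint motzkin_from (t : nat) (p : seq 'I_3) : bool :=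
  if p is x :: p' then
    match nat_of_ord x with
    | 0 => (0 < t) && motzkin_from t.-1 p'
    | 1 => motzkin_from t p'
    | _ => motzkin_from t.+1 p'
    end
  else t == 0.

Lemma height_cons x p : height (x :: p) = (step_height x + height p)%R.
Proof. exact: big_cons. Qed.

Lemma motzkin_fromP t p :
  reflect ((forall j, (0 <= t%:Z + height (take j p))%R)
           /\ (t%:Z + height p = 0)%R)
          (motzkin_from t p).
Proof.
elim: p t => [|x p IHp] t /=.
  rewrite /height big_nil GRing.addr0; apply: (iffP eqP) => [->|[_]]; last by lia.
  by split.
(* Treats the three kinds of step at once: [b] says that the step is allowed, and [u] is the height
   it leads to. *)
have E (u : nat) (b : bool) : (b -> u%:Z = t%:Z + step_height x)%R ->
    (b = (0 <= t%:Z + step_height x)%R) ->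
    reflect ((forall j, (0 <= t%:Z + height (take j (x :: p)))%R)
           /\ (t%:Z + height (x :: p) = 0)%R) (b && motzkin_from u p).
  move=> uE bE; apply: (iffP andP) => [[bT /IHp [pos tot]]|[pos tot]].
    split=> [[|j]|]; first by rewrite take0 /height big_nil GRing.addr0.
      by have := pos j; rewrite uE //= height_cons -GRing.addrA.
    by move: tot; rewrite uE // height_cons -GRing.addrA.
  have bT : b.
    have := pos 1; rewrite /= take0 height_cons /height big_nil GRing.addr0.
    by rewrite bE.
  split=> //; apply/IHp; rewrite uE // -GRing.addrA -height_cons; split=> // j.
  by rewrite -GRing.addrA -height_cons; apply: (pos j.+1).
case: x E => [[|[|[|x]]] ltx] //= E.
- by apply: E; rewrite /step_height /=; lia.
- by apply: (E t true); rewrite /step_height /=; lia.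
- by apply: (E t.+1 true); rewrite /step_height /=; lia.
Qed.

Lemma sum_motzkin_from k t :
  \sum_(p : k.-tuple 'I_3) motzkin_from t p = half_walks0 k t.
Proof.
elim: k t => [|k IHk] t; first by rewrite (big_tuple0 _ (motzkin_from t)).
rewrite (big_tuple_cons _ _ (motzkin_from t)) !big_ord_recl big_ord0 /=.
rewrite half_walks0S -!IHk; case: t => [|t] /=; last by lia.
by rewrite big1 //; lia.
Qed.

Lemma motzkinE k : motzkin k = half_walks0 k 0.
Proof.
rewrite /motzkin card_set_sum -sum_motzkin_from; apply: eq_bigr => p _.
congr nat_of_bool; apply/idP/motzkin_fromP => [/andP[/forallP pos /eqP tot]|].
  split=> [j|]; rewrite GRing.add0r //.
  case: (ltnP j k.+1) => [ltj|lekj]; first exact: (pos (Ordinal ltj)).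
  by rewrite take_oversize ?tot // size_tuple ltnW.
move=> [pos tot]; apply/andP; split; last by rewrite -tot GRing.add0r.
by apply/forallP => j; rewrite -[height _]GRing.add0r.
Qed.

(** * The closed formula for [I_num] *)

(** The sum in (iii) for a table with [n.+1] columns. *)
Definition weighted_motzkin_sum (n : nat) : nat :=
  \sum_(0 <= k < n - 1) (n - k - 1) * 3 ^ (n - k - 2) * motzkin k.

(** Each weight [n - k] is split as [(n - k - 1) + 1]. *)
Lemma weighted_motzkin_sumS n :
  weighted_motzkin_sum n.+1
  = 3 * weighted_motzkin_sum n + \sum_(0 <= k < n) 3 ^ (n - k.+1) * motzkin k.
Proof.
rewrite /weighted_motzkin_sum subn1 /=; case: n => [|n].
  by rewrite !big_geq.
rewrite subn1 /= !(big_nat_recr n) //= subnn addnA.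
rewrite big_distrr -big_split /=; congr (_ + _).
  apply: eq_big_nat => k /andP[_ ltkn] /=.
  have -> : n.+2 - k - 1 = (n - k).+1 by lia.
  have -> : n.+2 - k - 2 = n - k by lia.
  have -> : n.+1 - k - 1 = n - k by lia.
  have -> : n.+1 - k.+1 = n - k by lia.
  have -> : n.+1 - k - 2 = n - k.+1 by lia.
  by rewrite -(subnSK ltkn) expnS; lia.
by have -> : n.+2 - n = 2 by lia.
Qed.

(** Formula (iii) for [n.+1] columns, multiplied by 3 and with the negative term moved across, so
    that it can be stated in [nat]. *)
Lemma I_num_closed m n : n < m ->
  3 * I_num m n.+1 + 2 * n * 3 ^ n
  = 3 * m * 3 ^ n + 6 * weighted_motzkin_sum n.
Proof.
elim: n => [|n IHn] ltnm.
  rewrite I_numE /weighted_motzkin_sum big_geq // sum_nat_const card_ord.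
  by rewrite expn0; lia.
have := IHn (ltnW ltnm); have := I_numS m n (ltnW ltnm).
(* This turns the loss [2 * half_walks n 0] into [2 * 3 ^ n] minus the very sum by which
   [weighted_motzkin_sum] grows, doubled. *)
have := half_walks_first_exit n; rewrite weighted_motzkin_sumS expnS.
under eq_bigr => k _ do rewrite -motzkinE.
by nia.
Qed.

Theorem theorem2p11 (m n : nat) (hn : 1 <= n) (hm1 : 1 <= m)
    (hm : 2 * n - 2 <= m) :
  [/\ \sum_(0 <= i < n) D_num m i 1 * D_num m (n - i) 1 = 3 ^ (n - 1),
      \sum_(1 <= i < n) D_num m i 1 * D_num m (n - i) 1
        = \sum_(0 <= i < n - 1) 3 ^ (n - i - 2) * motzkin i
    & ((I_num m n)%:R
        = (3 * m%:R - 2 * n%:R + 2) * 3 ^ (n%:Z - 2)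
          + 2 * \sum_(0 <= k < (n - 2)%N)
                  (n - k - 2)%N%:R * 3 ^+ (n - k - 3)%N * (motzkin k)%:R
        :> rat)%R].
Proof.
case: n hn hm => [//|n] _ hm; rewrite subn1 /=.
have ltnm : n < m by lia.
have tail_sum : \sum_(1 <= i < n.+1) D_num m i 1 * D_num m (n.+1 - i) 1
    = \sum_(0 <= i < n) half_walks i 0 * half_walks (n - i.+1) 0.
  rewrite big_add1 /=; apply: eq_big_nat => i /andP[_ ltin].
  by rewrite subSS -(subnSK ltin) !D_num1 //; lia.
have conv := half_walks_convolution n; split.
(* By the convention for [D(0,1)], the term [i = 0] is [half_walks n 0]. *)
- by rewrite big_ltn // tail_sum subn0 D_num1 // mul1n.
(* The convolution and the first-exit sum both complete [half_walks n 0] to [3 ^ n], hence are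
   equal. *)
- rewrite tail_sum; have := half_walks_first_exit n.
  rewrite -conv => /addnI <-; apply: eq_big_nat => i _.
  by rewrite motzkinE; congr (3 ^ _ * _); lia.
have -> : (\sum_(0 <= k < (n.+1 - 2)%N)
    (n.+1 - k - 2)%N%:R * 3 ^+ (n.+1 - k - 3)%N * (motzkin k)%:R
    = (weighted_motzkin_sum n)%:R :> rat)%R.
  rewrite /weighted_motzkin_sum GRing.natr_sum subSS.
  apply: eq_bigr => k _; rewrite !GRing.natrM GRing.natrX.
  have -> : n.+1 - k - 2 = n - k - 1 by lia.
  by have -> : n.+1 - k - 3 = n - k - 2 by lia.
(* The integer exponent is -1 for a single column, hence the division in [rat]. *)
have -> : ((3 : rat) ^ (n.+1%:Z - 2) = 3 ^+ n / 3)%R.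
  have -> : (n.+1%:Z - 2 = n%:Z - 1)%R by lia.
  by rewrite expfzDr.
have /(congr1 (fun a : nat => a%:R : rat)%R) := I_num_closed m n ltnm.
rewrite !GRing.natrD !GRing.natrM !GRing.natrX -[(n.+1)%:R%R]GRing.natr1.
by lra.
Qed.
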